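(* Let $A$ be a positive information algebra, let $L$ be a join-semilattice disjoint from $A$, and let $S=A\uplus_{\mathrm{ord}}L$ be the overflow semiring. Then the multiplicatively idempotent elements of the polynomial semiring $S[X]$ (those $f$ with $f^2=f$) are exactly the constant polynomials $c$ with $c\in I^\times(A)\cup L$, where $I^\times(A)=\{a\in A: a^2=a\}$.
   Context: All semirings are commutative: $(S,+,0)$ and $(S,\cdot,1)$ are commutative monoids, $1\neq 0$, multiplication distributes over addition, and $0$ is absorbing. A semiring is zerosumfree if $a+b=0$ implies $a=b=0$, and entire if $ab=0$ implies $a=0$ or $b=0$; an information algebra is a zerosumfree entire semiring. A positive information algebra is an information algebra with a partial order $\leq$ compatible with $+$ and $\cdot$ (i.e. $x\leq y$ implies $x+z\leq y+z$ and $xz\leq yz$) and having $0$ as least element. Overflow semiring $S=A\uplus_{\mathrm{ord}}L$: for a positive information algebra $A$ and a join-semilattice $L$ disjoint from $A$, $S=A\cup L$ with the order extending those of $A$ and $L$ by $a\leq\ell$ for all $a\in A,\ell\in L$ (and never $\ell\leq a$), and operations: $x+y=x+_Ay$ if $x,y\in A$, $x+y=\sup\{x,y\}$ otherwise; $xy=x\cdot_Ay$ if $x,y\in A\setminus\{0\}$, $xy=0$ if $x=0$ or $y=0$, and $xy=\sup\{x,y\}$ otherwise. With these, $S$ is a positive information algebra. *)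

(* Defs.v *)
From HB Require Import structures.
From mathcomp Require Import all_boot all_order all_algebra.

Set Implicit Arguments.
Unset Strict Implicit.
Unset Printing Implicit Defensive.

Import Order.TTheory GRing.Theory.
Local Open Scope ring_scope.

HB.mixin Record isInfoAlg S of GRing.ComNzSemiRing S := {
  zerosumfree : forall a b : S, a + b = 0 -> a = 0 /\ b = 0;
  entire : forall a b : S, a * b = 0 -> a = 0 \/ b = 0
}.

#[short(type="infoAlgType")]
HB.structure Definition InfoAlg := {S of GRing.ComNzSemiRing S & isInfoAlg S}.

(* The order is a field of the mixin and not a porderType structure: HB accepts
   no structure besides porderZmodType above both the additive and the order
   hierarchies, and S has no opposite. *)
HB.mixin Record isPosInfoAlg S of InfoAlg S := {
  pia_le : rel S;
  pia_le_refl : reflexive pia_le;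
  pia_le_anti : antisymmetric pia_le;
  pia_le_trans : transitive pia_le;
  pia_leD2r : forall z x y : S, pia_le x y -> pia_le (x + z) (y + z);
  pia_leM2r : forall z x y : S, pia_le x y -> pia_le (x * z) (y * z);
  pia_le0x : forall x : S, pia_le 0 x
}.

#[short(type="posInfoAlgType")]
HB.structure Definition PosInfoAlg := {S of InfoAlg S & isPosInfoAlg S}.

Definition mul_idempotent (R : nzSemiRingType) (x : R) : Prop := x ^+ 2 = x.

(* The semilattice L may be empty.  The disjoint union is the sum type, under a
   new name because the operations and the order below depend on A and L. *)
Definition overflow (d : Order.disp_t) (A : posInfoAlgType)
  (L : joinSemilatticeType d) : Type := (A + L)%type.

Section Overflow.
Context (d : Order.disp_t) (A : posInfoAlgType) (L : joinSemilatticeType d).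
Notation S := (overflow A L).

HB.instance Definition _ := Choice.copy S (A + L)%type.

Definition overflow_le (x y : S) : bool :=
  match x, y with
  | inl a, inl b => pia_le a b
  | inl _, inr _ => true
  | inr _, inl _ => false
  | inr l, inr m => (l <= m)%O
  end.

(* Since a <= l for a in A and l in L, the supremum of a and l is l;
   see overflow_add_lub and overflow_mul_lub. *)
Definition overflow_add (x y : S) : S :=
  match x, y with
  | inl a, inl b => inl (a + b)
  | inl _, inr l | inr l, inl _ => inr l
  | inr l, inr m => inr (l `|` m)%O
  end.

Definition overflow_mul (x y : S) : S :=
  match x, y with
  | inl a, inl b => inl (a * b)
  | inl a, inr l | inr l, inl a => if a == 0 then inl 0 else inr l
  | inr l, inr m => inr (l `|` m)%O
  end.

Fact overflow_le_refl : reflexive overflow_le.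
Proof. by case=> x //=; apply: pia_le_refl. Qed.

Fact overflow_le_anti : antisymmetric overflow_le.
Proof. by case=> x [] y //= => [/pia_le_anti|/le_anti] ->. Qed.

Fact overflow_le_trans : transitive overflow_le.
Proof. by case=> x [] y [] z //=; [apply: pia_le_trans | apply: le_trans]. Qed.

Fact overflow_addA : associative overflow_add.
Proof. by case=> x [] y [] z //=; rewrite ?addrA ?joinA. Qed.

Fact overflow_addC : commutative overflow_add.
Proof. by case=> x [] y //=; rewrite ?(addrC x) ?(joinC x). Qed.

Fact overflow_add0 : left_id (inl 0) overflow_add.
Proof. by case=> x //=; rewrite add0r. Qed.

HB.instance Definition _ := GRing.isNmodule.Build S
  overflow_addA overflow_addC overflow_add0.

Let mul_eq0 (a b : A) : (a * b == 0) = (a == 0) || (b == 0).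
Proof.
apply/eqP/orP => [/entire[]->|[]/eqP->]; rewrite ?eqxx ?mul0r ?mulr0; auto.
Qed.

Let add_eq0 (a b : A) : (a + b == 0) = (a == 0) && (b == 0).
Proof.
by apply/eqP/andP => [/zerosumfree[-> ->]|[/eqP-> /eqP->]]; rewrite ?addr0.
Qed.

Fact overflow_mulC : commutative overflow_mul.
Proof. by case=> x [] y //=; rewrite ?(mulrC x) ?(joinC x). Qed.

Fact overflow_mulA : associative overflow_mul.
Proof.
case=> x [] y [] z /=; rewrite ?mulrA ?joinA //.
- rewrite mul_eq0; case: (y == 0); rewrite /= ?mulr0 ?orbT //.
  by case: (x == 0).
- case: (eqVneq x 0) => [->|/negbTE x0]; case: (eqVneq z 0) => [->|/negbTE z0];
    by rewrite /= ?mulr0 ?mul0r ?x0 ?z0 ?eqxx.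
- by case: (x == 0); rewrite /= ?eqxx.
- rewrite mul_eq0; case: (y == 0) => //=; rewrite ?mul0r //.
- by case: (y == 0); rewrite /= ?eqxx.
- by case: (z == 0); rewrite /= ?eqxx.
Qed.

Fact overflow_mul1 : left_id (inl 1) overflow_mul.
Proof. by case=> x //=; rewrite ?mul1r ?oner_eq0. Qed.

Fact overflow_mulDl : left_distributive overflow_mul overflow_add.
Proof.
case=> x [] y [] z /=; rewrite ?mulrDl ?add_eq0 //.
- by case: (x == 0); case: (y == 0); rewrite /= ?addr0 ?joinxx.
- by case: eqVneq => [->|]; rewrite /= ?mulr0 ?addr0.
- by case: (x == 0); rewrite /= ?(joinCA z) ?joinxx ?(joinC y).
- by case: eqVneq => [->|]; rewrite /= ?mulr0 ?addr0.
- by case: (y == 0); rewrite /= -?joinA ?joinxx.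
- by case: (z == 0); rewrite /= ?addr0.
- by rewrite joinACA joinxx.
Qed.

Fact overflow_mul0 : left_zero (inl 0) overflow_mul.
Proof. by case=> x /=; rewrite ?mul0r ?eqxx. Qed.

Fact overflow_1_neq0 : (inl 1 : S) != inl 0.
Proof. by apply/eqP => -[/eqP]; rewrite oner_eq0. Qed.

HB.instance Definition _ := GRing.Nmodule_isComNzSemiRing.Build S
  overflow_mulA overflow_mulC overflow_mul1 overflow_mulDl overflow_mul0
  overflow_1_neq0.

Fact overflow_zerosumfree (x y : S) : x + y = 0 -> x = 0 /\ y = 0.
Proof. by case: x y => x [] y // [/zerosumfree[-> ->]]. Qed.

Fact overflow_entire (x y : S) : x * y = 0 -> x = 0 \/ y = 0.
Proof.
case: x y => x [] y //.
- by case=> /entire[]->; [left|right].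
- by rewrite /GRing.mul /=; case: eqVneq => // -> _; left.
- by rewrite /GRing.mul /=; case: eqVneq => // -> _; right.
Qed.

HB.instance Definition _ := isInfoAlg.Build S
  overflow_zerosumfree overflow_entire.

Fact overflow_leD2r (z x y : S) :
  overflow_le x y -> overflow_le (x + z) (y + z).
Proof.
case: x y z => x [] y [] z //; rewrite /GRing.add /=.
- exact: pia_leD2r.
- by move=> _; apply: lexx.
- by rewrite leUr.
- by move=> xy; apply: leU2 => //; apply: lexx.
Qed.

Fact overflow_leM2r (z x y : S) :
  overflow_le x y -> overflow_le (x * z) (y * z).
Proof.
case: x y z => x [] y [] z //; rewrite /GRing.mul /=.
- exact: pia_leM2r.
- move=> xy; case: (eqVneq y 0) xy => [-> x0|y0 _].
    have -> : x = 0 by apply: pia_le_anti; rewrite x0 pia_le0x.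
    by rewrite eqxx /= pia_le_refl.
  by case: eqVneq => //= _; apply: lexx.
- by case: eqVneq => [->|] //=; rewrite mulr0 pia_le_refl.
- by case: eqVneq => //= _; rewrite leUr.
- by case: (z == 0) => /= xy; rewrite ?pia_le_refl.
- by move=> xy; apply: leU2 => //; apply: lexx.
Qed.

Fact overflow_le0x (x : S) : overflow_le 0 x.
Proof. by case: x => //= a; apply: pia_le0x. Qed.

HB.instance Definition _ := isPosInfoAlg.Build S
  overflow_le_refl overflow_le_anti overflow_le_trans
  overflow_leD2r overflow_leM2r overflow_le0x.

Definition in_overflow (x : S) : bool := if x is inr _ then true else false.

Definition is_lub (x y s : S) : Prop :=
  [/\ pia_le x s, pia_le y s
    & forall u, pia_le x u -> pia_le y u -> pia_le s u].

Let lub_cases (x y : S) : in_overflow x || in_overflow y ->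
  is_lub x y (overflow_add x y).
Proof.
case: x y => x [] y // _; split=> //=; do ?exact: lexx.
- by rewrite /pia_le /= leUl.
- by rewrite /pia_le /= leUr.
- by case=> u //; rewrite /pia_le /= leUx => -> ->.
Qed.

Lemma overflow_add_lub (x y : S) :
  in_overflow x || in_overflow y -> is_lub x y (x + y).
Proof. exact: lub_cases. Qed.

Lemma overflow_mul_lub (x y : S) :
  in_overflow x || in_overflow y -> x != 0 -> y != 0 -> is_lub x y (x * y).
Proof.
move=> xy x0 y0; have := lub_cases xy.
suff -> : x * y = overflow_add x y by [].
case: x y xy x0 y0 => x [] y // _; rewrite /GRing.mul /=.
- by case: (eqVneq x 0) => // ->; rewrite eqxx.
- by case: (eqVneq y 0) => // -> _; rewrite eqxx.
Qed.

End Overflow.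

(* Main.v *)
(** Over an entire semiring leading coefficients multiply to a nonzero element,
    so [f ^+ 2] has twice the degree of [f]; an idempotent polynomial is therefore
    a constant, and every element of [L] is idempotent because join is. *)
Require Import Defs.
From mathcomp Require Import all_boot all_order all_algebra.

Import Order.TTheory GRing.Theory.
Local Open Scope ring_scope.

(** The constant embedding is an injective semiring morphism. *)
Lemma mul_idempotent_polyC (R : nzSemiRingType) (c : R) :
  mul_idempotent c%:P <-> mul_idempotent c.
Proof.
by rewrite /mul_idempotent -rmorphXn; split=> [/polyC_inj|->].
Qed.

Lemma mul_idempotent_poly_size {R : infoAlgType} {f : {poly R}} :
  mul_idempotent f -> (size f <= 1)%N.
Proof.
rewrite /mul_idempotent expr2 => ff; have [->|f0] := eqVneq f 0.
  by rewrite size_poly0.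
have lc0 : lead_coef f * lead_coef f != 0.
  by apply/eqP => /entire[] /eqP; rewrite lead_coef_eq0 (negbTE f0).
have := size_proper_mul lc0; rewrite ff.
(* Here [size f = (size f + size f).-1], which holds for sizes 0 and 1 but fails from 2 on. *)
by case: (size f) => [|[|n]] //; rewrite addSn addnS /= => /eqP;
  rewrite -[X in X == _]addn0 !addSn !eqSS eqn_add2l.
Qed.

Lemma overflow_mul_idempotent (d : Order.disp_t) (A : posInfoAlgType)
    (L : joinSemilatticeType d) (c : overflow A L) :
  mul_idempotent c <->
  (exists2 a : A, mul_idempotent a & c = inl a) \/ (exists l : L, c = inr l).
Proof.
rewrite /mul_idempotent expr2; split.
  (* Two elements of [A] multiply inside [A], so injectivity of [inl] gives [a * a = a]. *)
  case: c => [a [aa]|l _]; last by right; exists l.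
  by left; exists a; rewrite // /mul_idempotent expr2.
case=> [[a]|[l]] => [|->].
  by rewrite /mul_idempotent expr2 => aa ->; congr inl.
by congr inr; apply: joinxx.
Qed.

Theorem proposition3p10 (d : Order.disp_t) (A : posInfoAlgType)
    (L : joinSemilatticeType d) (f : {poly (overflow A L)}) :
  mul_idempotent f <->
  exists2 c : overflow A L,
    (exists2 a : A, mul_idempotent a & c = inl a) \/ (exists l : L, c = inr l)
    & f = c%:P.
Proof.
split=> [ff|[c /overflow_mul_idempotent cc ->]]; last exact/mul_idempotent_polyC.
have fC := size1_polyC (mul_idempotent_poly_size ff).
(* The constant coefficient is the witness, since [f] has size at most 1. *)
exists f`_0 => //; apply/overflow_mul_idempotent/mul_idempotent_polyC.
by rewrite -fC.
Qed.
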